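(* For any fixed positive integers $l,m$, with $l\leq m$, Algorithm $EXC(G,l,m)$ (described in the context) computes in polynomial time $\chi'_{[l,m]}(G)$ and, if $\chi'_{[l,m]}(G)<\infty$, outputs an excessive $[l,m]$-factorization of $G$.
   Context: A matching of a graph $G$ is a set of pairwise non-adjacent edges of $G$. For positive integers $l\leq m$, an $[l,m]$-covering of $G$ is a set $\mathcal{M}$ of matchings of $G$ whose union is $E(G)$ and such that $l\leq |M|\leq m$ for every $M\in\mathcal{M}$. An excessive $[l,m]$-factorization of $G$ is an $[l,m]$-covering of $G$ of minimum cardinality. The excessive $[l,m]$-index $\chi'_{[l,m]}(G)$ is the cardinality of an excessive $[l,m]$-factorization of $G$ if one exists, and $\infty$ otherwise. When $l=m$ one writes excessive $[m]$-factorization and $\chi'_{[m]}(G)$. A $k$-edge colouring of $G$ is a map from $E(G)$ to a set of $k$ colours giving distinct colours to adjacent edges; its colour classes are the sets of edges of a given colour. An $m$-bounded edge colouring is an edge colouring whose colour classes all have size at most $m$; it is optimal if it uses the least possible number of colours, which is $\chi'_{[1,m]}(G)$. A $k$-edge colouring is equalized if every colour class $C$ satisfies $\lfloor |E(G)|/k\rfloor\leq |C|\leq\lceil |E(G)|/k\rceil$. The algorithm uses three known subroutines: (A) for each fixed positive integer $m$, a polynomial time algorithm (Rizzi and Cariolaro) which, given $G$, outputs $\chi'_{[1,m]}(G)$ and an excessive $[1,m]$-factorization of $G$, which may be taken to be an optimal $m$-bounded edge colouring; (B) for each fixed positive integer $m$, a polynomial time algorithm (Cariolaro and Rizzi) which,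 given $G$, outputs $\chi'_{[m]}(G)$ and, if this is finite, an excessive $[m]$-factorization of $G$; (C) an algorithm (McDiarmid, de Werra) which transforms a $k$-edge colouring of $G$ into an equalized $k$-edge colouring of $G$ in time $O(|V||E|)$. Algorithm $EXC(G,l,m)$: 1. Input $G$. 2. Compute, using (A), $\chi'_{[1,l]}(G)$, $\chi'_{[1,m]}(G)$ and an optimal $m$-bounded edge colouring $\varphi$ of $G$. 3. If $\chi'_{[1,m]}(G)<\chi'_{[1,l]}(G)$, transform $\varphi$ into an equalized edge colouring $\varphi'$ using (C), and 4. return $\chi'_{[1,m]}(G)$ and $\varphi'$ (whose colour classes are the output set of matchings). 5. Else compute $\chi'_{[l]}(G)$ and, if $\chi'_{[l]}(G)<\infty$, an excessive $[l]$-factorization $\mathcal{M}$ of $G$, using (B). 6. Return $\chi'_{[l]}(G)$ and, if $\chi'_{[l]}(G)<\infty$, $\mathcal{M}$. *)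

(* Defs.v *)
From HB Require Import structures.
From mathcomp Require Import all_boot all_order all_algebra.

Set Implicit Arguments.
Unset Strict Implicit.
Unset Printing Implicit Defensive.

(** * Graphs, matchings, coverings and edge colourings *)

(* A finite simple graph on the vertices 0, ..., n-1; an edge is the set of
   its two endpoints. *)
Record sgraph := SGraph {
  nvertices : nat;
  edges : {set {set 'I_nvertices}};
  edges_card2 : forall e, e \in edges -> #|e| = 2 }.

Definition adjacent (T : finType) (e f : {set T}) : bool :=
  (e != f) && (e :&: f != set0).

Definition matching (G : sgraph) (M : {set {set 'I_(nvertices G)}}) : bool :=
  (M \subset edges G) && [forall e in M, forall f in M, ~~ adjacent e f].

Definition covering (G : sgraph) (l m : nat)
    (Ms : {set {set {set 'I_(nvertices G)}}}) : bool :=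
  [forall M in Ms, matching M && (l <= #|M| <= m)] && (cover Ms == edges G).

Definition excessive_factorization (G : sgraph) (l m : nat)
    (Ms : {set {set {set 'I_(nvertices G)}}}) : bool :=
  covering l m Ms &&
  [forall Ns : {set {set {set 'I_(nvertices G)}}},
     covering l m Ns ==> (#|Ms| <= #|Ns|)].

(* [None] is the value infinity. *)
Definition excessive_index (G : sgraph) (l m : nat) : option nat :=
  if [pick Ms : {set {set {set 'I_(nvertices G)}}} | excessive_factorization l m Ms]
  is Some Ms then Some #|Ms| else None.

Definition edge (G : sgraph) : finType :=
  {e : {set 'I_(nvertices G)} | e \in edges G}.

Definition edge_colouring (G : sgraph) (k : nat)
    (phi : {ffun edge G -> 'I_k}) : Prop :=
  forall e f : edge G, adjacent (val e) (val f) -> phi e <> phi f.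

Definition colour_class (G : sgraph) (k : nat)
    (phi : {ffun edge G -> 'I_k}) (c : 'I_k) : {set {set 'I_(nvertices G)}} :=
  [set val e | e : edge G & phi e == c].

Definition bounded_colouring (G : sgraph) (m k : nat)
    (phi : {ffun edge G -> 'I_k}) : Prop :=
  edge_colouring phi /\ forall c : 'I_k, #|colour_class phi c| <= m.

Definition optimal_bounded_colouring (G : sgraph) (m k : nat)
    (phi : {ffun edge G -> 'I_k}) : Prop :=
  bounded_colouring m phi /\
  forall (k' : nat) (psi : {ffun edge G -> 'I_k'}),
    bounded_colouring m psi -> k <= k'.

Definition ceil_div (a k : nat) : nat := a %/ k + ~~ (k %| a).

Definition equalized_colouring (G : sgraph) (k : nat)
    (phi : {ffun edge G -> 'I_k}) : Prop :=
  edge_colouring phi /\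
  forall c : 'I_k,
    #|edges G| %/ k <= #|colour_class phi c| <= ceil_div #|edges G| k.

(** * The machine model *)

(* Programs are those of Jones's WHILE language over binary trees, a model
   polynomially equivalent to Turing machines, extended with calls of closed
   procedures (a call runs its body in a fresh store, so it can be inlined by
   renaming variables). *)
Inductive data := Nil | Cons of data & data.

Fixpoint dsize (d : data) : nat :=
  if d is Cons a b then (dsize a + dsize b).+1 else 1.

Definition hd (d : data) : data := if d is Cons a _ then a else Nil.
Definition tl (d : data) : data := if d is Cons _ b then b else Nil.

Inductive expr :=
  | Var of nat
  | ENil
  | ECons of expr & expr
  | EHd of expr
  | ETl of expr.

Inductive cmd :=
  | Assign of nat & expr
  | Seq of cmd & cmd
  | If of expr & cmd & cmd
  | While of expr & cmd
  | Call of nat & cmd & expr.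

Definition store := nat -> data.

Definition update (s : store) (x : nat) (d : data) : store :=
  fun y => if y == x then d else s y.

Definition init (d : data) : store := update (fun _ => Nil) 0 d.

Fixpoint eval (s : store) (a : expr) : data :=
  match a with
  | Var x => s x
  | ENil => Nil
  | ECons b c => Cons (eval s b) (eval s c)
  | EHd b => hd (eval s b)
  | ETl b => tl (eval s b)
  end.

(* Each elementary operation is charged the full size of the tree it yields
   (no unit-cost sharing), so that a polynomial running time also bounds the
   sizes of all trees built. *)
Fixpoint ecost (s : store) (a : expr) : nat :=
  match a with
  | Var _ | ENil => dsize (eval s a)
  | ECons b c => ecost s b + ecost s c + dsize (eval s a)
  | EHd b | ETl b => ecost s b + dsize (eval s a)
  end.

(* [exec s c s' t]: from store [s], the command [c] halts in store [s'] after
   time [t].  The empty tree is "false", every other tree is "true". *)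
Inductive exec : store -> cmd -> store -> nat -> Prop :=
  | ExecAssign s x a :
      exec s (Assign x a) (update s x (eval s a)) (ecost s a)
  | ExecSeq s c1 s1 t1 c2 s2 t2 :
      exec s c1 s1 t1 -> exec s1 c2 s2 t2 -> exec s (Seq c1 c2) s2 (t1 + t2)
  | ExecIfTrue s a c1 c2 s' t :
      eval s a <> Nil -> exec s c1 s' t -> exec s (If a c1 c2) s' (ecost s a + t)
  | ExecIfFalse s a c1 c2 s' t :
      eval s a = Nil -> exec s c2 s' t -> exec s (If a c1 c2) s' (ecost s a + t)
  | ExecWhileTrue s a c s1 t1 s2 t2 :
      eval s a <> Nil -> exec s c s1 t1 -> exec s1 (While a c) s2 t2 ->
      exec s (While a c) s2 (ecost s a + t1 + t2)
  | ExecWhileFalse s a c :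
      eval s a = Nil -> exec s (While a c) s (ecost s a)
  | ExecCall s x p a s' t :
      exec (init (eval s a)) p s' t ->
      exec s (Call x p a) (update s x (s' 0)) (ecost s a + t + dsize (s' 0)).

(* The program [p] receives [d] in variable 0, halts within time [t], and
   leaves in variable 0 a result satisfying [Q]. *)
Definition outputs_within (p : cmd) (d : data) (t : nat) (Q : data -> Prop) :
    Prop :=
  exists s' t', [/\ exec (init d) p s' t', t' <= t & Q (s' 0)].

(** * Representation of the inputs and outputs by trees *)

Fixpoint nat_code (n : nat) : data :=
  if n is n'.+1 then Cons Nil (nat_code n') else Nil.

(* Infinity is [Nil], hence the shift by one for the finite values. *)
Definition index_code (i : option nat) : data :=
  if i is Some k then nat_code k.+1 else Nil.

Fixpoint codes_seq (T : Type) (R : T -> data -> Prop) (s : seq T) (d : data) :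
    Prop :=
  match s, d with
  | [::], Nil => True
  | x :: s', Cons a b => R x a /\ codes_seq R s' b
  | _, _ => False
  end.

(* A set is represented by any repetition-free list of its elements. *)
Definition codes_set (T : finType) (R : T -> data -> Prop) (A : {set T})
    (d : data) : Prop :=
  exists s : seq T, [/\ uniq s, s =i A & codes_seq R s d].

Definition codes_edge (n : nat) : {set 'I_n} -> data -> Prop :=
  codes_set (fun (i : 'I_n) d => d = nat_code i).

Definition codes_edges (n : nat) : {set {set 'I_n}} -> data -> Prop :=
  codes_set (@codes_edge n).

Definition codes_graph (G : sgraph) (d : data) : Prop :=
  exists2 de, codes_edges (edges G) de & d = Cons (nat_code (nvertices G)) de.

(* A colouring is represented by the list of its colour classes, in the order
   of the colours. *)
Definition codes_colouring (G : sgraph) (k : nat)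
    (phi : {ffun edge G -> 'I_k}) (d : data) : Prop :=
  codes_seq (@codes_edges (nvertices G)) [seq colour_class phi c | c <- enum 'I_k] d.

(* The answer is the pair of the index and, if the index is finite, an
   excessive factorization. *)
Definition codes_excessive_answer (l m : nat) (G : sgraph) (d : data) : Prop :=
  exists dM, d = Cons (index_code (excessive_index G l m)) dM /\
    (excessive_index G l m <> None ->
     exists2 Ms : {set {set {set 'I_(nvertices G)}}},
       excessive_factorization l m Ms & codes_set (@codes_edges _) Ms dM).

Definition computes_excessive_in_polytime (l m : nat) (p : cmd) : Prop :=
  exists P : {poly nat}, forall (G : sgraph) (d : data), codes_graph G d ->
    outputs_within p d P.[dsize d]%R (codes_excessive_answer l m G).

(** * The three subroutines and the algorithm *)

Definition codes_optimal_answer (m : nat) (G : sgraph) (d : data) : Prop :=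
  exists dphi, d = Cons (index_code (excessive_index G 1 m)) dphi /\
    exists (k : nat) (phi : {ffun edge G -> 'I_k}),
      optimal_bounded_colouring m phi /\ codes_colouring phi dphi.

(* Rizzi and Cariolaro, for a fixed m *)
Definition subroutineA (m : nat) (p : cmd) : Prop :=
  exists P : {poly nat}, forall (G : sgraph) (d : data), codes_graph G d ->
    outputs_within p d P.[dsize d]%R (codes_optimal_answer m G).

(* Cariolaro and Rizzi, for a fixed m *)
Definition subroutineB (m : nat) (p : cmd) : Prop :=
  computes_excessive_in_polytime m m p.

(* McDiarmid, de Werra.  Their bound O(|V||E|) counts random-access machine
   steps; only its consequence that the time is polynomial is required. *)
Definition subroutineC (p : cmd) : Prop :=
  exists P : {poly nat},
  forall (G : sgraph) (k : nat) (phi : {ffun edge G -> 'I_k}) (dG dphi : data),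
    edge_colouring phi -> codes_graph G dG -> codes_colouring phi dphi ->
    outputs_within p (Cons dG dphi) P.[dsize (Cons dG dphi)]%R
      (fun d => exists2 psi : {ffun edge G -> 'I_k},
                  equalized_colouring psi & codes_colouring psi d).

Declare Scope cmd_scope.
Delimit Scope cmd_scope with cmd.
Notation "c1 ;; c2" := (Seq c1 c2) (at level 80, right associativity) : cmd_scope.

(* Variable 0 holds G.  The loop decrements the unary numbers held in
   variables 3 and 4, initially the [1,l]-index and the [1,m]-index, until the
   latter vanishes; variable 3 is then non-empty iff the [1,m]-index is the
   smaller one. *)
Definition EXC (A B : nat -> cmd) (C : cmd) (l m : nat) : cmd :=
  (Call 1 (A l) (Var 0) ;;
   Call 2 (A m) (Var 0) ;;
   Assign 3 (EHd (Var 1)) ;;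
   Assign 4 (EHd (Var 2)) ;;
   While (Var 4) (Assign 3 (ETl (Var 3)) ;; Assign 4 (ETl (Var 4))) ;;
   If (Var 3)
     (Call 5 C (ECons (Var 0) (ETl (Var 2))) ;;
      Assign 0 (ECons (EHd (Var 2)) (Var 5)))
     (Call 0 (B l) (Var 0)))%cmd.

(* Main.v *)
Require Import Defs.
From mathcomp Require Import all_boot all_order all_algebra.
From mathcomp Require Import zify.

Set Implicit Arguments.
Unset Strict Implicit.
Unset Printing Implicit Defensive.

(** Write [a] and [b] for the [1,l]- and [1,m]-indices of [G]; they are the
    least numbers of colours of an [l]-bounded and of an [m]-bounded edge
    colouring ([optimal_colouring_index]).  Since every [l,m]-covering is a
    [1,m]-covering, it has at least [b] members.

    If [b < a], the equalized [b]-edge colouring has all its classes of size at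
    least [l]: otherwise [|E| < l * b], all classes have size at most [l], and
    [b] colours suffice for an [l]-bounded colouring.  They have size at most
    [m] because [|E| <= m * b].  So the classes form an [l,m]-covering with [b]
    members, the least possible number ([excessive_of_equalized]).

    If [a <= b], every [l,m]-covering has [N >= b >= a] members, whence
    [|E| <= l * a <= l * N].  Such a covering can be shrunk to an [l]-covering
    with at most [N] members ([exact_covering]), so that the [l,m]-index is the
    [l]-index and an excessive [l]-factorization is an excessive
    [l,m]-factorization ([excessive_exact]).  For the shrinking, consider a
    family of [N] matchings of size at least [l] covering [E], one of them, [M],
    of size more than [l].  The sizes add up to more than [|E|], so some edge
    [e] lies in two members.  If one of these is larger than [l], remove [e]
    from it.  Otherwise let [M'] be one of these two members; then
    [|M' \ e| = l - 1], and moving one unit of size from [M] to [M' \ e] by an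
    exchange ([matching_exchange]) gives two matchings of size at least [l] with
    the same union as [M] and [M' \ e], while the other member still covers
    [e].  In both cases the total size has dropped by one ([exact_family]).

    The running time is polynomial because a program running for time [t]
    increases the size of each variable by at most [t] ([dsize_exec]), so that the
    outputs of the subroutines, and hence the inputs of later calls, have
    polynomial size, and because the comparison loop runs once per unit of the
    unary code of [b] ([exec_countdown]). *)

(** * Exchanging edges between two matchings *)

Lemma matchingE (G : sgraph) (M : {set {set 'I_(nvertices G)}}) :
  matching M = (M \subset edges G) && trivIset M.
Proof.
rewrite /matching; congr (_ && _).
apply/forall_inP/trivIsetP => [h e f eM fM nef | h e eM].
  have /forall_inP/(_ f fM) := h e eM.
  by rewrite /adjacent nef /= negbK -setI_eq0.
apply/forall_inP => f fM; rewrite /adjacent negb_and !negbK -implyNb.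
by apply/implyP => nef; rewrite setI_eq0 h.
Qed.

Lemma trivIset_setU1 (T : finType) (e : {set T}) (M : {set {set T}}) :
  trivIset M -> [disjoint e & cover M] -> trivIset (e |: M).
Proof.
move=> tM deM; apply: trivIsetU => //; last by rewrite cover1.
by apply/trivIsetP => A B /set1P-> /set1P->; rewrite eqxx.
Qed.

Lemma card_cover_matching (T : finType) (M : {set {set T}}) :
  trivIset M -> {in M, forall e : {set T}, #|e| = 2} -> #|cover M| = #|M|.*2.
Proof.
move=> /eqP <- M2; rewrite (eq_bigr (fun=> 2)); last by [].
by rewrite sum_nat_const muln2.
Qed.

Lemma cover_setU (T : finType) (M N : {set {set T}}) :
  cover (M :|: N) = cover M :|: cover N.
Proof. by rewrite /cover bigcup_setU. Qed.

Lemma disjoint_setUr (T : finType) (A B C : {set T}) :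
  [disjoint A & B :|: C] = [disjoint A & B] && [disjoint A & C].
Proof. by rewrite -!setI_eq0 setIUr setU_eq0. Qed.

Lemma trivIset_eq (T : finType) (M : {set {set T}}) e f x :
  trivIset M -> e \in M -> f \in M -> x \in e -> x \in f -> e = f.
Proof.
move=> tM eM fM xe xf.
by rewrite -(def_pblock tM eM xe) (def_pblock tM fM xf).
Qed.

(** One unit of size can be moved from a matching to a smaller one, keeping every
    edge with its multiplicity; preserving the intersection, not only the union,
    is what the induction needs.  Take an edge [f] of [M] with an end that [N]
    misses.  If [N] misses [f] entirely, move [f] to [N].  Otherwise let [e] be
    the edge of [N] meeting [f]; apply the induction hypothesis to [M] without
    [f] and [N] without [e], then put [e] and [f] back on different sides. *)
Lemma matching_exchange (T : finType) (M N : {set {set T}}) :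
  trivIset M -> trivIset N -> {in M :|: N, forall e : {set T}, #|e| = 2} ->
  #|N| < #|M| ->
  exists M' N', [/\ trivIset M', trivIset N', M' :|: N' = M :|: N,
                    M' :&: N' = M :&: N & #|M| = #|M'|.+1].
Proof.
have [n] := ubnP #|N|; elim: n M N => // n IH M N leN tM tN MN2 ltNM.
have M2 : {in M, forall e : {set T}, #|e| = 2} by move=> e eM; apply: MN2; rewrite inE eM.
have N2 : {in N, forall e : {set T}, #|e| = 2}.
  by move=> e eN; apply: MN2; rewrite inE eN orbT.
(* A larger matching covers more vertices. *)
have /subsetPn[u /bigcupP[f fM uf] uN] : ~~ (cover M \subset cover N).
  apply: contraL ltNM => /subset_leq_card.
  by rewrite !card_cover_matching // leq_double -leqNgt.
have fN : f \notin N.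
  by apply: contra uN => fN; apply/bigcupP; exists f.
have tM1 : trivIset (M :\ f) by apply: trivIsetS tM; apply: subD1set.
have dfM1 : [disjoint f & cover (M :\ f)].
  rewrite coverD1 //; apply/pred0P => x /=.
  by rewrite inE; case: (x \in f).
have [dfN | ndfN] := boolP [disjoint f & cover N].
  exists (M :\ f), (f |: N); split => //.
  - exact: trivIset_setU1.
  - by rewrite setUCA setUA setD1K.
  - apply/setP => x; rewrite !inE; case: eqP => //= ->.
    by rewrite (negPf fN) andbF.
  - by rewrite (cardsD1 f M) fM.
have /pred0Pn[v /= /andP[vf /bigcupP[e eN ve]]] := ndfN.
have eM : e \notin M.
  by apply: contra fN => eM; rewrite -(trivIset_eq tM eM fM ve vf).
have nef : e != f by apply: contraNneq fN => <-.
have tN1 : trivIset (N :\ e) by apply: trivIsetS tN; apply: subD1set.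
have cM : #|M| = #|M :\ f|.+1 by rewrite (cardsD1 f M) fM.
have cN : #|N| = #|N :\ e|.+1 by rewrite (cardsD1 e N) eN.
have [|//|//|||M' [N' [tM' tN' eU eI cM']]] := IH (M :\ f) (N :\ e).
- by rewrite -ltnS -cN.
- by move=> g; rewrite !inE => /orP[]/andP[_ h]; apply: MN2; rewrite inE h ?orbT.
- by rewrite -ltnS -cM -cN.
have nuv : u != v.
  apply: contraNneq uN => ->; by apply/bigcupP; exists e.
have fuv : f = [set u; v].
  apply/esym/eqP; rewrite eqEcard cards2 nuv M2 // leqnn andbT.
  by apply/subsetP => x; rewrite !inE => /orP[]/eqP->.
have memU x : (x \in M') || (x \in N') = (x \in M :\ f) || (x \in N :\ e).
  by rewrite -!in_setU eU.
have memI x : (x \in M') && (x \in N') = (x \in M :\ f) && (x \in N :\ e).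
  by rewrite -!in_setI eI.
have vcover g : g \in M :\ f -> v \notin g.
  rewrite !inE => /andP[ngf gM]; apply: contra ngf => vg.
  by rewrite (trivIset_eq tM gM fM vg vf).
have dfU : [disjoint f & cover (M' :|: N')].
  rewrite eU cover_setU disjoint_setUr dfM1 fuv /=.
  apply/pred0P => x /=; apply/negP => /andP[].
  rewrite !inE => /orP[]/eqP-> /bigcupP[g]; rewrite !inE => /andP[nge gN] xg.
    by case/bigcupP: uN; exists g.
  by rewrite (trivIset_eq tN gN eN xg ve) eqxx in nge.
move: dfU; rewrite cover_setU disjoint_setUr => /andP[dfM' dfN'].
have eMN' : (e \notin M') && (e \notin N').
  by rewrite -negb_or memU !inE eqxx (negPf eM) !andbF.
have fMN' : (f \notin M') && (f \notin N').
  by rewrite -negb_or memU !inE eqxx (negPf fN) !andbF.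
case/andP: eMN' => eM' eN'; case/andP: fMN' => fM' fN'.
(* [e] meets no edge of [N :\ e] and no edge of [M :\ f] at [v], and its other
   end lies on at most one edge of [M :\ f], hence [e] can be added to [M'] or to
   [N']. *)
have : [disjoint e & cover M'] || [disjoint e & cover N'].
  rewrite -[_ || _]negbK negb_or; apply/negP => /andP[].
  move=> /pred0Pn[x /= /andP[xe /bigcupP[g gM' xg]]].
  move=> /pred0Pn[y /= /andP[ye /bigcupP[h hN' yh]]].
  have gU : (g \in M :\ f) || (g \in N :\ e) by rewrite -memU gM'.
  have hU : (h \in M :\ f) || (h \in N :\ e) by rewrite -memU hN' orbT.
  have nN z (k : {set T}) : z \in e -> z \in k -> k \notin N :\ e.
    move=> ze zk; rewrite !inE negb_and negbK -implyNb; apply/implyP => nke.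
    by apply: contra nke => kN; rewrite (trivIset_eq tN kN eN zk ze).
  rewrite (negPf (nN _ _ xe xg)) orbF in gU.
  rewrite (negPf (nN _ _ ye yh)) orbF in hU.
  have nxv : v != x by apply: contraTneq xg => <-; apply: vcover.
  have nyv : v != y by apply: contraTneq yh => <-; apply: vcover.
  have exv : e = [set v; x].
    apply/esym/eqP; rewrite eqEcard cards2 nxv N2 // leqnn andbT.
    by apply/subsetP => z; rewrite !inE => /orP[]/eqP->.
  have yx : y = x.
    by apply/eqP; move: ye; rewrite exv !inE eq_sym (negPf nyv).
  rewrite yx in yh; have hg := trivIset_eq tM1 hU gU yh xg.
  have := memI g; rewrite gM' -hg hN' => /esym/andP[_].
  by apply/negP; apply: nN xe _; rewrite hg.
case/orP => de.
- exists (e |: M'), (f |: N'); split; try exact: trivIset_setU1.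
  + apply/setP => x; have := memU x; rewrite !inE.
    case: (x =P e) => [->|_]; first by rewrite eN orbT.
    case: (x =P f) => [->|_]; first by rewrite fM orbT.
    by [].
  + apply/setP => x; have := memI x; rewrite !inE.
    case: (x =P e) => [->|_]; first by rewrite (negPf nef) (negPf eN') (negPf eM).
    case: (x =P f) => [->|_]; first by rewrite (negPf fM') (negPf fN) !andbF.
    by [].
  + by rewrite cardsU1 eM' cM cM'.
- exists (f |: M'), (e |: N'); split; try exact: trivIset_setU1.
  + apply/setP => x; have := memU x; rewrite !inE.
    case: (x =P e) => [->|_]; first by rewrite eN !orbT.
    case: (x =P f) => [->|_]; first by rewrite fM.
    by [].
  + apply/setP => x; have := memI x; rewrite !inE.
    case: (x =P e) => [->|_]; first by rewrite (negPf nef) (negPf eM') (negPf eM).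
    case: (x =P f) => [->|_]; first by rewrite (negPf fN') (negPf fN) !andbF.
    by [].
  + by rewrite cardsU1 fM' cM cM'.
Qed.

(** * Shrinking a covering to matchings of the same size *)

(** [F] is a family rather than a set of matchings, so that repetitions, which
    the exchanges may create, do not change the number of members. *)
Lemma exact_family (I T : finType) (E : {set {set T}}) (l : nat)
    (F : I -> {set {set T}}) :
  {in E, forall e : {set T}, #|e| = 2} ->
  (forall i, trivIset (F i)) -> (forall i, l <= #|F i|) ->
  \bigcup_i F i = E -> #|E| <= l * #|I| ->
  exists F' : I -> {set {set T}},
    [/\ forall i, trivIset (F' i), forall i, #|F' i| = l & \bigcup_i F' i = E].
Proof.
move=> E2; have [n] := ubnP (\sum_i #|F i|); elim: n F => // n IH F lt_n tF lF FE leE.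
have [/forallP h | /forallPn[i1 ni1]] := boolP [forall i, #|F i| == l].
  by exists F; split => // i; apply/eqP.
have li1 : l < #|F i1| by rewrite ltn_neqAle eq_sym ni1 lF.
have FsubE k x : x \in F k -> x \in E by move=> xk; rewrite -FE; apply/bigcupP; exists k.
(* An edge covered twice can be removed from a member that is large enough. *)
have drop i j e : i != j -> e \in F i -> e \in F j -> l < #|F i| ->
    exists F' : I -> {set {set T}},
    [/\ forall i, trivIset (F' i), forall i, #|F' i| = l & \bigcup_i F' i = E].
  move=> nij ei ej li; have ci : #|F i| = #|F i :\ e|.+1 by rewrite (cardsD1 e) ei.
  apply: (IH (fun k => if k == i then F i :\ e else F k)) => //.
  - rewrite ltnS in lt_n; apply: leq_trans lt_n; rewrite (bigD1 i) //= eqxx.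
    rewrite [X in _ < X](bigD1 i) //= ci addSn ltnS leq_add2l.
    by apply: leq_sum => k /negPf ->.
  - by move=> k; case: eqP => // _; apply: trivIsetS (tF i); apply: subD1set.
  - by move=> k; case: eqP => // _; rewrite -ltnS -ci.
  - rewrite -FE; apply/setP => x; apply/bigcupP/bigcupP => -[k _].
      by case: eqP => _; [rewrite inE => /andP[_]; exists i | exists k].
    have [-> xe|nxe] := eqVneq x e; first by exists j; rewrite // eq_sym (negPf nij).
    have [->|nki] := eqVneq k i => xk; last by exists k; rewrite // (negPf nki).
    by exists i; rewrite // eqxx !inE nxe.
have ltE : #|E| < \sum_i #|F i|.
  apply: leq_ltn_trans leE _; rewrite mulnC -sum_nat_const (bigD1 i1) //=.
  by rewrite [X in _ < X](bigD1 i1) //= -addSn leq_add // leq_sum.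
have [i [j [e [nij ei ej]]]] : exists i j e, [/\ i != j, e \in F i & e \in F j].
  have [/forallP dis | /forallPn[i /forallPn[j]]] :=
    boolP [forall i, forall j, (i != j) ==> [disjoint F i & F j]].
    move: ltE; rewrite -FE -sum1_card partition_disjoint_bigcup; last first.
      by move=> i j; have /forallP/(_ j)/implyP := dis i.
    by under eq_bigr do rewrite sum1_card; rewrite ltnn.
  by rewrite negb_imply => /andP[nij /pred0Pn[e /andP[ei ej]]]; exists i, j, e.
have [li|lei] := ltnP l #|F i|; first exact: drop nij ei ej li.
have [lj|lej] := ltnP l #|F j|; first by apply: drop ej ei lj; rewrite eq_sym.
(* Both members containing [e] have size exactly [l], so neither is [F i1]. *)
have ni1i : i1 != i by apply: contraTneq li1 => ->; rewrite -leqNgt.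
have ni1j : i1 != j by apply: contraTneq li1 => ->; rewrite -leqNgt.
have ci : #|F i| = #|F i :\ e|.+1 by rewrite (cardsD1 e) ei.
have lF1 : #|F i| = l by apply/eqP; rewrite eqn_leq lei lF.
have [||||M' [N' [tM' tN' eU eI cM']]] := @matching_exchange T (F i1) (F i :\ e).
- exact: tF.
- by apply: trivIsetS (tF i); apply: subD1set.
- by move=> x; rewrite !inE => /orP[|/andP[_]] h; apply: E2; apply: FsubE h.
- by rewrite -ltnS -ci lF1 ltnS ltnW.
have cN' : #|N'| = l.
  have := cardsUI M' N'; rewrite eU eI cardsUI cM' addSnnS -ci lF1.
  by move/addnI.
have memU x : (x \in M') || (x \in N') = (x \in F i1) || (x \in F i :\ e).
  by rewrite -!in_setU eU.
apply: (IH (fun k => if k == i then N' else if k == i1 then M' else F k)) => //.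
- rewrite ltnS in lt_n; apply: leq_trans lt_n; rewrite (bigD1 i) //= eqxx.
  rewrite [X in _ < X](bigD1 i) //= (bigD1 i1) //= (negPf ni1i) eqxx.
  rewrite [X in _ < _ + X](bigD1 i1) //= cN' lF1 cM' addSn addnS ltnS.
  by rewrite !leq_add2l; apply: leq_sum => k /andP[/negPf -> /negPf ->].
- by move=> k; case: eqP => // _; case: eqP.
- move=> k; case: eqP => [_|_]; first by rewrite cN'.
  by case: eqP => // _; rewrite -ltnS -cM'.
- rewrite -FE; apply/setP => x; apply/bigcupP/bigcupP => -[k _].
    have aux : x \in M' \/ x \in N' -> exists2 k, true & x \in F k.
      move/orP; rewrite memU => /orP[|]; first by exists i1.
      by rewrite inE => /andP[_]; exists i.
    case: eqP => _; first by move=> xN; apply: aux; right.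
    case: eqP => _; last by exists k.
    by move=> xM; apply: aux; left.
  have [-> xe|nxe] := eqVneq x e.
    by exists j; rewrite // eq_sym (negPf nij) eq_sym (negPf ni1j).
  have aux : x \in F i1 \/ x \in F i ->
      exists2 k, true & x \in (if k == i then N' else if k == i1 then M' else F k).
    move=> h; have /orP[xM|xN] : (x \in M') || (x \in N').
    + by rewrite memU !inE nxe; apply/orP.
    + by exists i1; rewrite // (negPf ni1i) eqxx.
    + by exists i; rewrite // eqxx.
  have [->|nki] := eqVneq k i => [xk|]; first by apply: aux; right.
  have [->|nki1] := eqVneq k i1 => xk; first by apply: aux; left.
  by exists k; rewrite // (negPf nki) (negPf nki1).
Qed.

(** * Coverings and bounded edge colourings *)

Lemma coveringP (G : sgraph) l m (Ms : {set {set {set 'I_(nvertices G)}}}) :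
  reflect ((forall M, M \in Ms -> [/\ matching M, l <= #|M| & #|M| <= m]) /\
           cover Ms = edges G)
          (covering l m Ms).
Proof.
apply: (iffP andP) => -[h /eqP c]; split=> //.
  by move=> M MMs; have /andP[-> /andP[-> ->]] := forall_inP h M MMs.
by apply/forall_inP => M /h[-> -> ->].
Qed.

Lemma covering_imset (G : sgraph) l m (I : finType) (P : pred I)
    (F : I -> {set {set 'I_(nvertices G)}}) :
  (forall i, P i -> [/\ matching (F i), l <= #|F i| & #|F i| <= m]) ->
  \bigcup_(i | P i) F i = edges G ->
  covering l m [set F i | i : I & P i].
Proof.
move=> h U; apply/coveringP; split.
  by move=> M /imsetP[i]; rewrite inE => /h hi ->.
by rewrite cover_imset -U; apply: eq_bigl => i; rewrite inE.
Qed.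

Lemma coveringW (G : sgraph) l m l' m'
    (Ms : {set {set {set 'I_(nvertices G)}}}) :
  l' <= l -> m <= m' -> covering l m Ms -> covering l' m' Ms.
Proof.
move=> ll mm /coveringP[h c]; apply/coveringP; split=> // M /h[-> lM Mm].
by split=> //; [exact: leq_trans lM | exact: leq_trans mm].
Qed.

Lemma excessive_factorizationP (G : sgraph) l m
    (Ms : {set {set {set 'I_(nvertices G)}}}) :
  reflect (covering l m Ms /\ forall Ns : {set {set {set 'I_(nvertices G)}}},
             covering l m Ns -> #|Ms| <= #|Ns|)
          (excessive_factorization l m Ms).
Proof.
apply: (iffP andP) => -[cM h]; split=> //.
  by move=> Ns; move/forallP/(_ Ns)/implyP: h; apply.
by apply/forallP => Ns; apply/implyP; apply: h.
Qed.

Lemma excessive_index_Some (G : sgraph) l m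
    (Ms : {set {set {set 'I_(nvertices G)}}}) :
  excessive_factorization l m Ms -> excessive_index G l m = Some #|Ms|.
Proof.
move=> hM; rewrite /excessive_index; case: pickP => [Ns hN | /(_ Ms)]; last by rewrite hM.
congr Some; apply/eqP; rewrite eqn_leq.
move: hM hN => /excessive_factorizationP[cM lM] /excessive_factorizationP[cN lN].
by rewrite lM ?lN.
Qed.

Lemma excessive_exists (G : sgraph) l m
    (Ms : {set {set {set 'I_(nvertices G)}}}) :
  covering l m Ms ->
  exists Ns : {set {set {set 'I_(nvertices G)}}}, excessive_factorization l m Ns.
Proof.
move=> cM; case: (arg_minnP (fun Ns : {set {set {set 'I_(nvertices G)}}} => #|Ns|) cM).
by move=> Ns cN h; exists Ns; apply/excessive_factorizationP.
Qed.

Lemma excessive_indexP (G : sgraph) l m :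
  excessive_index G l m <> None ->
  exists Ms : {set {set {set 'I_(nvertices G)}}}, excessive_factorization l m Ms.
Proof. by rewrite /excessive_index; case: pickP => // Ms hM _; exists Ms. Qed.

Lemma mem_colour_class (G : sgraph) k (phi : {ffun edge G -> 'I_k}) c e :
  (val e \in colour_class phi c) = (phi e == c).
Proof.
apply/imsetP/eqP => [[f] | pe]; last by exists e; rewrite ?inE ?pe.
by rewrite inE => /eqP <- /val_inj ->.
Qed.

Lemma colour_classP (G : sgraph) k (phi : {ffun edge G -> 'I_k}) c x :
  reflect (exists2 e : edge G, val e = x & phi e = c) (x \in colour_class phi c).
Proof.
apply: (iffP imsetP) => -[e]; first by rewrite inE => /eqP pe ->; exists e.
by move=> <- pe; exists e; rewrite // inE pe.
Qed.

Lemma bigcup_colour_class (G : sgraph) k (phi : {ffun edge G -> 'I_k}) :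
  \bigcup_c colour_class phi c = edges G.
Proof.
apply/setP => x; apply/bigcupP/idP => [[c _ /colour_classP[e <- _]] | xE].
  exact: valP.
exists (phi (exist _ x xE)); rewrite //.
by rewrite -[x]/(val (exist _ x xE : edge G)) mem_colour_class.
Qed.

Lemma colour_class_inj (G : sgraph) k (phi : {ffun edge G -> 'I_k}) c d :
  0 < #|colour_class phi c| -> colour_class phi c = colour_class phi d -> c = d.
Proof.
case/card_gt0P => x xc E; move: (xc); rewrite E.
case/colour_classP: xc => e <- <-.
by rewrite mem_colour_class => /eqP.
Qed.

Lemma colour_class_matching (G : sgraph) k (phi : {ffun edge G -> 'I_k}) c :
  edge_colouring phi -> matching (colour_class phi c).
Proof.
move=> h; apply/andP; split.
  by rewrite -(bigcup_colour_class phi) bigcup_sup.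
apply/forall_inP => x /colour_classP[e <- pe].
apply/forall_inP => y /colour_classP[f <- pf].
by apply/negP => /h; rewrite pe pf.
Qed.

Lemma card_edges_bounded (G : sgraph) m k (phi : {ffun edge G -> 'I_k}) :
  bounded_colouring m phi -> #|edges G| <= m * k.
Proof.
case=> _ h; rewrite -(bigcup_colour_class phi).
have -> : m * k = \sum_(c < k) m by rewrite sum_nat_const card_ord mulnC.
apply: leq_trans (_ : \sum_c #|colour_class phi c| <= _); last exact: leq_sum.
elim/big_rec2: _ => [|c n A _ IH]; first by rewrite cards0.
by apply: leq_trans (leq_card_setU _ _) _; rewrite leq_add2l.
Qed.

Lemma colouring_of_covering (G : sgraph) l m
    (Ms : {set {set {set 'I_(nvertices G)}}}) :
  covering l m Ms ->
  exists phi : {ffun edge G -> 'I_#|Ms|}, bounded_colouring m phi.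
Proof.
case/coveringP => hM cM.
have ex (e : edge G) : exists i : 'I_#|Ms|, val e \in enum_val i.
  have /bigcupP[M MMs eM] : val e \in cover Ms by rewrite cM; apply: valP.
  by exists (enum_rank_in MMs M); rewrite enum_rankK_in.
(* Colour each edge by one of the matchings that contain it. *)
pose phi := [ffun e : edge G => xchoose (ex e)].
have phiP e : val e \in enum_val (phi e) by rewrite ffunE; exact: (xchooseP (ex e)).
exists phi; split.
  move=> e f aef pef; have [+ _ _] := hM _ (enum_valP (phi e)).
  case/andP => _ /forall_inP/(_ _ (phiP e))/forall_inP/(_ (val f)).
  by rewrite {1}pef phiP aef => /(_ isT).
move=> c; have [_ _] := hM _ (enum_valP c); apply: leq_trans.
by apply/subset_leq_card/subsetP => x /colour_classP[e <- <-].
Qed.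

(** The non-empty classes of an [m]-bounded colouring form a [1,m]-covering, and a
    covering by [N] matchings yields a colouring with [N] colours. *)
Lemma optimal_colouring_index (G : sgraph) m k (phi : {ffun edge G -> 'I_k}) :
  optimal_bounded_colouring m phi -> excessive_index G 1 m = Some k.
Proof.
case=> -[ephi bphi] opt.
pose Ms := [set colour_class phi c | c : 'I_k & colour_class phi c != set0].
have cM : covering 1 m Ms.
  apply: covering_imset => [c|].
    by rewrite -card_gt0; split => //; apply: colour_class_matching.
  rewrite -(bigcup_colour_class phi) big_mkcond; apply: eq_bigr => c _.
  by case: eqP.
have minM (Ns : {set {set {set 'I_(nvertices G)}}}) : covering 1 m Ns -> k <= #|Ns|.
  by case/colouring_of_covering => psi /opt.
(* An optimal colouring has no empty class, as [Ms] has at least [k] members. *)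
have Mk : #|Ms| = k.
  apply/eqP; rewrite eqn_leq minM // andbT -[X in _ <= X]card_ord.
  by apply: leq_trans (leq_imset_card _ _) _; apply: max_card.
rewrite -[k]Mk; apply: excessive_index_Some; apply/excessive_factorizationP.
by rewrite Mk.
Qed.

(** * The two branches of the algorithm *)

Lemma ceil_div_le a k l : 0 < k -> a <= l * k -> ceil_div a k <= l.
Proof.
move=> k0 alk; rewrite /ceil_div; have [ka|nka] /= := boolP (k %| a).
  by rewrite addn0 -(leq_pmul2r k0) divnK.
rewrite addn1 ltn_divLR // ltn_neqAle alk andbT.
by apply: contraNneq nka => ->; apply: dvdn_mull.
Qed.

(** The branch [b < a], where [k] is [b]: no colouring with [k] colours is
    [l]-bounded. *)
Lemma excessive_of_equalized (G : sgraph) l m k (phi psi : {ffun edge G -> 'I_k}) :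
  0 < l -> l <= m -> optimal_bounded_colouring m phi ->
  ~ (exists phi' : {ffun edge G -> 'I_k}, bounded_colouring l phi') ->
  equalized_colouring psi ->
  let Ms := [set colour_class psi c | c : 'I_k] in
  [/\ injective (colour_class psi), excessive_factorization l m Ms & #|Ms| = k].
Proof.
move=> l0 lm [bphi opt] nl [epsi qpsi] Ms.
have leE := card_edges_bounded bphi.
have lq (c : 'I_k) : l <= #|edges G| %/ k.
  have k0 : 0 < k by case: c => [c]; apply: leq_ltn_trans.
  rewrite leqNgt ltn_divLR //; apply/negP => /ltnW El; apply: nl; exists psi.
  split=> // d; have /andP[_] := qpsi d; move/leq_trans; apply.
  exact: ceil_div_le.
have bnd c : [/\ matching (colour_class psi c), l <= #|colour_class psi c|
               & #|colour_class psi c| <= m].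
  have k0 : 0 < k by case: (c) => [d]; apply: leq_ltn_trans.
  have /andP[h1 h2] := qpsi c; split; first exact: colour_class_matching.
    exact: leq_trans (lq c) h1.
  by apply: leq_trans h2 _; apply: ceil_div_le.
have inj : injective (colour_class psi).
  move=> c d; apply: colour_class_inj; case: (bnd c) => _ h _.
  exact: leq_trans h.
have cM : #|Ms| = k by rewrite card_imset // card_ord.
split=> //; apply/excessive_factorizationP; split.
  have := @covering_imset G l m _ predT (colour_class psi) (fun c _ => bnd c).
  move/(_ (bigcup_colour_class psi)); congr (covering _ _ _).
  by apply/setP => M; apply/imsetP/imsetP => -[c _ ->]; exists c.
move=> Ns cN; rewrite cM.
have [chi bchi] := colouring_of_covering cN; exact: opt bchi.
Qed.

Lemma exact_covering (G : sgraph) l m (Ms : {set {set {set 'I_(nvertices G)}}}) :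
  covering l m Ms -> #|edges G| <= l * #|Ms| ->
  exists2 Ns : {set {set {set 'I_(nvertices G)}}},
    covering l l Ns & #|Ns| <= #|Ms|.
Proof.
case/coveringP => hM cM leE.
have [|||||F [tF lF UF]] := @exact_family 'I_#|Ms| _ (edges G) l (fun i => enum_val i).
- by move=> e /edges_card2.
- by move=> i; have [+ _ _] := hM _ (enum_valP i); rewrite matchingE => /andP[].
- by move=> i; have [] := hM _ (enum_valP i).
- rewrite -cM /cover; apply/setP => x; apply/bigcupP/bigcupP => [[i _ xi]|[M MMs xM]].
    by exists (enum_val i); rewrite ?enum_valP.
  by exists (enum_rank_in MMs M); rewrite ?enum_rankK_in.
- by rewrite card_ord.
exists [set F i | i : 'I_#|Ms| & predT i].
  apply: covering_imset => // i _; rewrite lF; split=> //.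
  by rewrite matchingE tF andbT -UF bigcup_sup.
by apply: leq_trans (leq_imset_card _ _) _; rewrite -[X in _ <= X]card_ord max_card.
Qed.

(** The branch [a <= b], where the hypothesis on coverings holds by the bounds
    on the two indices.  The [l]-index may be infinite; then so is the
    [l,m]-index. *)
Lemma excessive_exact (G : sgraph) l m :
  l <= m ->
  (forall Ms : {set {set {set 'I_(nvertices G)}}},
     covering l m Ms -> #|edges G| <= l * #|Ms|) ->
  excessive_index G l m = excessive_index G l l /\
  forall Ms : {set {set {set 'I_(nvertices G)}}},
    excessive_factorization l l Ms -> excessive_factorization l m Ms.
Proof.
move=> lm hE.
have ex (Ms : {set {set {set 'I_(nvertices G)}}}) :
    excessive_factorization l l Ms -> excessive_factorization l m Ms.
  case/excessive_factorizationP => cM minM; apply/excessive_factorizationP.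
  split=> [|Ns cN]; first exact: coveringW cM.
  have [Ns' cN' leN] := exact_covering cN (hE _ cN).
  by apply: leq_trans leN; apply: minM.
split=> //; case E : (excessive_index G l l) => [k|].
  have [|Ms hMs] := @excessive_indexP G l l; first by rewrite E.
  by rewrite (excessive_index_Some (ex _ hMs)) -(excessive_index_Some hMs).
apply/eqP/negPn/negP => /eqP/excessive_indexP[Ms /excessive_factorizationP[cM _]].
have [Ns cN _] := exact_covering cM (hE _ cM).
have [Ns' /excessive_index_Some] := excessive_exists cN.
by rewrite E.
Qed.

(** * Polynomial bounds *)

(** [f] is bounded by a polynomial with natural coefficients. *)
Definition poly_bounded (f : nat -> nat) : Prop :=
  exists P : {poly nat}, forall n, f n <= P.[n]%R.

Lemma horner_nat_mono (P : {poly nat}) n n' : n <= n' -> P.[n]%R <= P.[n']%R.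
Proof.
move=> le; elim/poly_ind: P => [|P c IH]; first by rewrite !horner0.
by rewrite !hornerMXaddC leq_add2r; apply: leq_mul.
Qed.

Lemma poly_bounded_id : poly_bounded (fun n => n).
Proof. by exists 'X%R => n; rewrite hornerX. Qed.

Lemma poly_bounded_const c : poly_bounded (fun=> c).
Proof. by exists (c%:P)%R => n; rewrite hornerC. Qed.

Lemma poly_boundedD f g :
  poly_bounded f -> poly_bounded g -> poly_bounded (fun n => f n + g n).
Proof.
by move=> [P hP] [Q hQ]; exists (P + Q)%R => n; rewrite hornerD; apply: leq_add.
Qed.

Lemma poly_boundedM f g :
  poly_bounded f -> poly_bounded g -> poly_bounded (fun n => f n * g n).
Proof.
by move=> [P hP] [Q hQ]; exists (P * Q)%R => n; rewrite hornerM; apply: leq_mul.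
Qed.

Lemma poly_bounded_horner (P : {poly nat}) f :
  poly_bounded f -> poly_bounded (fun n => P.[f n]%R).
Proof.
move=> [Q hQ]; exists (P \Po Q)%R => n; rewrite horner_comp.
exact: horner_nat_mono.
Qed.

(** * Execution of the program *)

Lemma dsize_hd d : dsize (hd d) <= dsize d.
Proof. by case: d => //= a b; rewrite leqW // leq_addr. Qed.

Lemma dsize_tl d : dsize (tl d) <= dsize d.
Proof. by case: d => //= a b; rewrite leqW // leq_addl. Qed.

Lemma dsize_eval s a : dsize (eval s a) <= ecost s a.
Proof. by case: a => //= *; rewrite leq_addl. Qed.

(** Building a tree costs at least its size, so the time bounds the growth of
    every variable. *)
Lemma dsize_exec s c s' t :
  exec s c s' t -> forall x, dsize (s' x) <= dsize (s x) + t.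
Proof.
elim=> {s c s' t} //.
- move=> s y a x; rewrite /update; case: eqP => _; last exact: leq_addr.
  by apply: leq_trans (dsize_eval s a) _; apply: leq_addl.
- by move=> s c1 s1 t1 c2 s2 t2 _ h1 _ h2 x; have := h1 x; have := h2 x; lia.
- by move=> s a c1 c2 s' t _ _ h x; have := h x; lia.
- by move=> s a c1 c2 s' t _ _ h x; have := h x; lia.
- by move=> s a c s1 t1 s2 t2 _ _ h1 _ h2 x; have := h1 x; have := h2 x; lia.
- by move=> s a c _ x; apply: leq_addr.
- move=> s y p a s' t _ _ x; rewrite /update; case: eqP => _; lia.
Qed.

Lemma outputs_within_size p d t Q :
  outputs_within p d t Q ->
  exists s t', [/\ exec (init d) p s t', t' <= t, dsize (s 0) <= dsize d + t
                 & Q (s 0)].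
Proof.
move=> [s [t' [e le q]]]; exists s, t'; split=> //.
by apply: leq_trans (dsize_exec e 0) _; rewrite leq_add2l.
Qed.

Lemma nat_code_tl n : tl (nat_code n) = nat_code n.-1.
Proof. by case: n. Qed.

Lemma dsize_nat_code n : dsize (nat_code n) = n.*2.+1.
Proof. by elim: n => //= n ->; rewrite doubleS. Qed.

(** The comparison loop computes a truncated difference of unary numbers. *)
Lemma exec_countdown s i j D :
  s 3 = nat_code i -> s 4 = nat_code j ->
  dsize (s 3) <= D -> dsize (s 4) <= D ->
  exists s' t,
    [/\ exec s (While (Var 4)
                 (Seq (Assign 3 (ETl (Var 3))) (Assign 4 (ETl (Var 4))))) s' t,
        s' 3 = nat_code (i - j),
        forall x, x != 3 -> x != 4 -> s' x = s x
      & t <= j.+1 * (5 * D)].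
Proof.
elim: j s i => [|j IH] s i s3 s4 l3 l4.
  exists s, (ecost s (Var 4)); split; rewrite ?subn0 //.
    by apply: ExecWhileFalse.
  by rewrite /=; lia.
pose u := update (update s 3 (tl (s 3))) 4 (tl (s 4)).
have u3 : u 3 = nat_code i.-1 by rewrite /u /update /= s3 nat_code_tl.
have u4 : u 4 = nat_code j by rewrite /u /update /= s4.
have [||s' [t [e s'3 s'x le]]] := IH u i.-1 u3 u4.
- by rewrite /u /update /=; apply: leq_trans (dsize_tl _) l3.
- by rewrite /u /update /=; apply: leq_trans (dsize_tl _) l4.
have body : exec s (Seq (Assign 3 (ETl (Var 3))) (Assign 4 (ETl (Var 4)))) u
                 (ecost s (ETl (Var 3)) + ecost (update s 3 (tl (s 3))) (ETl (Var 4))).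
  by apply: ExecSeq; apply: ExecAssign.
have guard : eval s (Var 4) <> Defs.Nil by rewrite /= s4.
do 2 eexists; split; first exact: ExecWhileTrue guard body e.
- by rewrite s'3; congr nat_code; lia.
- by move=> x x3 x4; rewrite s'x // /u /update (negPf x3) (negPf x4).
- have := dsize_tl (s 3); have := dsize_tl (s 4).
  by move: le; rewrite /= /update /= [j.+2 * _]mulSn; lia.
Qed.

(** The classes of the equalized colouring are non-empty, hence pairwise
    distinct, so their list codes the set of the classes. *)
Lemma codes_excessive_answer_colouring l m (G : sgraph) k
    (phi psi : {ffun edge G -> 'I_k}) d :
  0 < l -> l <= m -> optimal_bounded_colouring m phi ->
  ~ (exists phi' : {ffun edge G -> 'I_k}, bounded_colouring l phi') ->
  equalized_colouring psi -> codes_colouring psi d ->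
  codes_excessive_answer l m G (Defs.Cons (index_code (Some k)) d).
Proof.
move=> l0 lm opt nl eq cd.
have [inj exc cM] := excessive_of_equalized l0 lm opt nl eq.
rewrite /codes_excessive_answer (excessive_index_Some exc) cM.
exists d; split=> // _; exists [set colour_class psi c | c : 'I_k] => //.
exists [seq colour_class psi c | c <- enum 'I_k]; split=> //.
  by rewrite map_inj_uniq // enum_uniq.
move=> M; apply/mapP/imsetP => -[c _ ->]; exists c => //.
by rewrite mem_enum.
Qed.

Theorem theorem7 (A B : nat -> cmd) (C : cmd)
    (hA : forall m : nat, 0 < m -> subroutineA m (A m))
    (hB : forall m : nat, 0 < m -> subroutineB m (B m))
    (hC : subroutineC C)
    (l m : nat) (hl : 0 < l) (hlm : l <= m) :
  computes_excessive_in_polytime l m (EXC A B C l m).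
Proof.
have [PAl hAl] := hA l hl.
have [PAm hAm] := hA m (leq_trans hl hlm).
have [PB hBl] := hB l hl.
have [PC hC'] := hC.
(* Bounds, for an input of size [n], on the sizes of the outputs of the calls:
   [r1] and [r2] for the two calls of [A], [r5] for [C] and [r0] for [B]. *)
pose r1 n := n + PAl.[n]%R.
pose r2 n := n + PAm.[n]%R.
pose r5 n := (n + r2 n + 1) + PC.[n + r2 n + 1]%R.
pose r0 n := n + PB.[n]%R.
pose D n := r1 n + r2 n.
(* The product bounds the time of the loop. *)
pose T n := 5 * D n + D n * (5 * D n) + (10 * r5 n + 10 * r2 n + 10 * r0 n).
have [P hP] : poly_bounded (fun n => T n).
  by rewrite /T /D /r0 /r5 /r1 /r2;
     repeat first [apply: poly_boundedD | apply: poly_boundedM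
       | apply: poly_bounded_horner | apply: poly_bounded_id
       | apply: poly_bounded_const].
exists P => G d cd; have hT := hP (dsize d).
have [s1 [t1 [e1 le1 sz1 [phi1 [E1 [a [f1 [opt1 _]]]]]]]] :=
  outputs_within_size (hAl G d cd).
have [s2 [t2 [e2 le2 sz2 [phi2 [E2 [b [f2 [opt2 cf2]]]]]]]] :=
  outputs_within_size (hAm G d cd).
rewrite (optimal_colouring_index opt1) in E1.
rewrite (optimal_colouring_index opt2) in E2.
(* The stores after the first four commands. *)
pose u1 := update (init d) 1 (s1 0); pose u2 := update u1 2 (s2 0).
pose u3 := update u2 3 (hd (s1 0)); pose u4 := update u3 4 (hd (s2 0)).
have hd1 : hd (s1 0) = nat_code a.+1 by rewrite E1.
have hd2 : hd (s2 0) = nat_code b.+1 by rewrite E2.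
have u43 : u4 3 = nat_code a.+1 by rewrite /u4 /u3 /update /= E1.
have u44 : u4 4 = nat_code b.+1 by rewrite /u4 /u3 /update /= E2.
have h1 := dsize_hd (s1 0); have h2 := dsize_hd (s2 0); have k2 := dsize_tl (s2 0).
have [||u [t [eu u_3 ux leu]]] := @exec_countdown u4 _ _ (D (dsize d)) u43 u44.
- by rewrite /u4 /u3 /update /= /D /r1 /r2; lia.
- by rewrite /u4 /u3 /update /= /D /r1 /r2; lia.
(* The execution up to the final conditional. *)
have pre K s' t' : exec u K s' t' ->
    exec (init d)
      (Seq (Call 1 (A l) (Var 0)) (Seq (Call 2 (A m) (Var 0))
        (Seq (Assign 3 (EHd (Var 1))) (Seq (Assign 4 (EHd (Var 2)))
          (Seq (While (Var 4) (Seq (Assign 3 (ETl (Var 3))) (Assign 4 (ETl (Var 4)))))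
             K))))) s'
      ((dsize d + t1 + dsize (s1 0)) + ((dsize d + t2 + dsize (s2 0)) +
       ((dsize (s1 0) + dsize (hd (s1 0))) +
        ((dsize (s2 0) + dsize (hd (s2 0))) + (t + t'))))).
  move=> eK.
  apply: (@ExecSeq _ _ u1); first exact: (@ExecCall (init d) 1 (A l) (Var 0)).
  apply: (@ExecSeq _ _ u2); first exact: (@ExecCall u1 2 (A m) (Var 0)).
  apply: (@ExecSeq _ _ u3); first exact: (@ExecAssign u2 3 (EHd (Var 1))).
  apply: (@ExecSeq _ _ u4); first exact: (@ExecAssign u3 4 (EHd (Var 2))).
  exact: ExecSeq eu eK.
have n1 : dsize d + t1 <= r1 (dsize d) by rewrite leq_add2l.
have n2 : dsize d + t2 <= r2 (dsize d) by rewrite leq_add2l.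
have u0 : u 0 = d by rewrite ux.
have uv2 : u 2 = s2 0 by rewrite ux.
have szd : dsize (u 3) <= D (dsize d).
  move: h1; rewrite u_3 hd1 !dsize_nat_code /D /r1; lia.
have leu' : t <= D (dsize d) * (5 * D (dsize d)).
  apply: leq_trans leu _; rewrite leq_mul2r; apply/orP; right.
  move: h2; rewrite hd2 dsize_nat_code /D /r2; lia.
(* Variable 3 now holds the unary code of [a - b]. *)
have [ltba | leab] := ltnP b a.
- have v3 : eval u (Var 3) <> Defs.Nil.
    by rewrite /= u_3 subSS -(subnSK ltba).
  have [s5 [t5 [e5 le5 sz5 [psi epsi cpsi]]]] :=
    outputs_within_size (hC' G b f2 d phi2 opt2.1.1 cd cf2).
  have szC : dsize (Defs.Cons d phi2) <= dsize d + r2 (dsize d) + 1.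
    by move: k2 sz2; rewrite E2 /r2 /=; lia.
  have lePC := horner_nat_mono PC szC.
  pose u5 := update u 5 (s5 0).
  have eC : exec u (Call 5 C (ECons (Var 0) (ETl (Var 2)))) u5
              (ecost u (ECons (Var 0) (ETl (Var 2))) + t5 + dsize (s5 0)).
    by apply: ExecCall; rewrite /= u0 uv2 E2.
  have eR := ExecAssign u5 0 (ECons (EHd (Var 2)) (Var 5)).
  do 2 eexists; split.
  + exact: pre (ExecIfTrue _ v3 (ExecSeq eC eR)).
  + apply: leq_trans hT; rewrite /T.
    have n5 : dsize d + r2 (dsize d) + 1 <= r5 (dsize d) by apply: leq_addr.
    have le5' : t5 <= r5 (dsize d).
      by apply: leq_trans le5 (leq_trans lePC _); apply: leq_addl.
    have sz5' : dsize (s5 0) <= r5 (dsize d).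
      by apply: leq_trans sz5 _; apply: leq_add.
    move: leu' szd; rewrite /= u0 uv2 /u5 /update /= uv2 /D.
    set X := _ * (5 * _); move: X n5 le5' sz5' n1 n2 sz1 sz2 h1 h2 k2.
    rewrite -/(r1 (dsize d)) -/(r2 (dsize d)).
    move: (r1 _) (r2 _) (r5 _) (r0 _) => v1 v2 v5 v0.
    lia.
  + rewrite /u5 /update /= uv2 E2 /=.
    apply: codes_excessive_answer_colouring opt2 _ epsi cpsi => //.
    by move=> [chi bchi]; have := opt1.2 _ _ bchi; lia.
- have v3 : eval u (Var 3) = Defs.Nil.
    by rewrite /= u_3 subSS (eqP leab).
  have [s5 [t5 [e5 le5 sz5 ans]]] := outputs_within_size (hBl G d cd).
  have eB : exec u (Call 0 (B l) (Var 0)) (update u 0 (s5 0))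
              (ecost u (Var 0) + t5 + dsize (s5 0)).
    by apply: ExecCall; rewrite /= u0.
  do 2 eexists; split.
  + exact: pre (ExecIfFalse _ v3 eB).
  + apply: leq_trans hT; rewrite /T.
    have n0 : dsize d + t5 <= r0 (dsize d) by rewrite leq_add2l.
    move: leu' szd; rewrite /= u0 /D.
    set X := _ * (5 * _); move: X n0 sz5 n1 n2 sz1 sz2 h1 h2.
    rewrite -/(r1 (dsize d)) -/(r2 (dsize d)) -/(r0 (dsize d)).
    move: (r1 _) (r2 _) (r5 _) (r0 _) => v1 v2 v5 v0.
    lia.
  + rewrite /update /=.
    have [||eqi exc] := @excessive_exact G l m; first exact: hlm.
      move=> Ms /colouring_of_covering[chi /opt2.2 leb].
      apply: leq_trans (card_edges_bounded opt1.1) _.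
      by rewrite leq_mul2l (leq_trans leab) ?orbT.
    case: ans => dM [-> h]; exists dM; rewrite eqi; split=> // /h[Ms /exc hM cM].
    by exists Ms.
Qed.
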